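(* Suppose the following holds for every $n\ge1$: whenever a convex body $K\subset\mathbb{C}^n$ is covered by a finite set of convex symplectic cylinders $\{Z_i\}$, one has $c_{HZ}(K)\le\sum_i c_{HZ}(Z_i)$, where $c_{HZ}$ is the Hofer--Zehnder capacity. Then for every $n\ge 1$: whenever the unit ball of $\mathbb{C}^n$ (with respect to the standard Hermitian norm) is covered by finitely many unitary cylinders $Z_i$ of radii $r_i$, one has $\sum_i r_i^2\ge 1$.
   Context: A convex body is a compact convex set with nonempty interior. $\mathbb{C}^n$ carries the Hermitian form $h(u,v)=\sum_i u_i\overline{v_i}$, the norm $\|u\|=\sqrt{h(u,u)}$, and its standard symplectic structure (given by $\operatorname{Im}h$, up to sign $\sum_j dx_j\wedge dy_j$). A unitary cylinder of radius $r>0$ is the (closed) $r$-neighborhood, in the Hermitian norm, of a complex affine hyperplane. A convex symplectic cylinder with cross-section $S$, where $S\subset\mathbb{C}$ is a convex body, is the set $S\times\mathbb{C}^{n-1}\subset\mathbb{C}^n$ or any image of it under a linear symplectic transformation composed with a translation. The Hofer--Zehnder capacity $c_{HZ}(U)$ of an open set $U\subset\mathbb{C}^n$ is the supremum of $m(H)$ over all smooth $H:U\to[0,m(H)]$ such that $H=m(H)$ outside some compact subset of $U$, $H=0$ on some nonempty open subset of $U$, and every periodic orbit of the Hamiltonian flow of $H$ of period $T$, $0<T\le1$, is constant. For closed convex sets with nonempty interior, the capacity is that of the interior. With this normalization the unit ball has capacity $\pi$ and a convex symplectic cylinder has capacity equal to the area of its cross-section $S$. *)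

(* Defs.v *)
From HB Require Import structures.
From mathcomp Require Import all_boot all_order all_algebra.
From mathcomp Require Import all_classical all_reals all_analysis.
From mathcomp Require Import complex.
Set Implicit Arguments.
Unset Strict Implicit.
Unset Printing Implicit Defensive.
Import Order.TTheory GRing.Theory Num.Theory.
Import numFieldNormedType.Exports.
Local Open Scope classical_set_scope.
Local Open Scope ring_scope.

(* C^n as a normed module over the reals: the pair (x, y) stands for x + iy.
   The library norm on this type is the sup norm; it is only used for the
   topology and for differentiation. The Hermitian norm is [hnorm] below. *)
Notation Cspace R n := ('rV[R]_n * 'rV[R]_n)%type.

Section ComplexSpace.
Variables (R : realType) (n : nat).
Implicit Types (u v z : Cspace R n) (A K : set (Cspace R n)).

Definition zcoord z (j : 'I_n) : R[i] := (z.1 0 j +i* z.2 0 j)%C.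

Definition hform u v : R[i] := \sum_(j < n) zcoord u j * (zcoord v j)^*%C.

Definition hnorm z : R := Num.sqrt (complex.Re (hform z z)).

(* The standard symplectic form, with the sign convention
   Im h = - \sum_j dx_j /\ dy_j. *)
Definition omega u v : R := complex.Im (hform u v).

Definition unit_ball : set (Cspace R n) := [set z | hnorm z <= 1].

Definition convex_body K :=
  [/\ compact K, convex_set (K : set (convex_lmodType (Cspace R n)))
    & K° !=set0].

Definition complex_affine_hyperplane A :=
  exists (a : 'rV[R[i]]_n) (c : R[i]),
    a != 0 /\ A = [set z | \sum_(j < n) a 0 j * zcoord z j = c].

Definition hneighborhood A (r : R) : set (Cspace R n) :=
  [set z | exists2 w, A w & hnorm (z - w) <= r].

Definition unitary_cylinder (r : R) (Z : set (Cspace R n)) :=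
  exists2 A, complex_affine_hyperplane A & Z = hneighborhood A r.

(* Smoothness on an open set: all iterated directional derivatives
   are Frechet differentiable at each of its points. *)
Definition smooth_on (U : set (Cspace R n)) (H : Cspace R n -> R) :=
  forall vs : seq (Cspace R n), forall z, U z ->
    differentiable (foldr (fun v (f : Cspace R n -> R) => 'D_v f) H vs) z.

(* An integral curve, defined for all times and contained in U, of the vector
   field X determined by omega (X, _) = dH. The opposite sign convention only
   reverses time. *)
Definition hamiltonian_orbit (U : set (Cspace R n)) (H : Cspace R n -> R)
    (g : R -> Cspace R n) :=
  forall t : R, [/\ U (g t), derivable g t 1
    & forall v, omega ('D_1 g t) v = 'D_v H (g t)].

Definition hz_admissible (U : set (Cspace R n)) (H : Cspace R n -> R) (m : R) :=
  [/\ smooth_on U H,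
      forall z, U z -> 0 <= H z <= m,
      exists K, [/\ compact K, K `<=` U & forall z, (U `\` K) z -> H z = m],
      exists V, [/\ open V, V !=set0, V `<=` U & forall z, V z -> H z = 0]
    & forall g, hamiltonian_orbit U H g ->
      forall T, 0 < T <= 1 -> (forall t, g (t + T) = g t) ->
      forall t, g t = g 0].

Definition hz_capacity_open (U : set (Cspace R n)) : \bar R :=
  ereal_sup [set m%:E | m in [set m | exists H, hz_admissible U H m]].

Definition hz_capacity K : \bar R := hz_capacity_open K°.

End ComplexSpace.

Section SymplecticCylinder.
Variables (R : realType) (n : nat).

Definition first_coord (z : Cspace R n.+1) : Cspace R 1 :=
  (\row_(_ < 1) z.1 0 ord0, \row_(_ < 1) z.2 0 ord0).

Definition standard_cylinder (S : set (Cspace R 1)) : set (Cspace R n.+1) :=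
  [set z | S (first_coord z)].

Definition linear_symplectic (L : Cspace R n.+1 -> Cspace R n.+1) :=
  linear L /\ forall u v, omega (L u) (L v) = omega u v.

Definition convex_symplectic_cylinder (Z : set (Cspace R n.+1)) :=
  exists S L (b : Cspace R n.+1), [/\ convex_body S, linear_symplectic L
    & Z = [set L z + b | z in standard_cylinder S]].

End SymplecticCylinder.

(* Main.v *)
Require Import Defs.
From HB Require Import structures.
From mathcomp Require Import all_boot all_order all_algebra.
From mathcomp Require Import all_classical all_reals all_analysis.
From mathcomp Require Import complex.
From mathcomp Require Import ring lra.
Set Implicit Arguments.
Unset Strict Implicit.
Unset Printing Implicit Defensive.
Import Order.TTheory GRing.Theory Num.Theory.
Import numFieldNormedType.Exports.
Local Open Scope classical_set_scope.
Local Open Scope ring_scope.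

(** Suppose that [\sum_i r_i ^+ 2 < 1] and let [l_i] be the affine form whose
    zero set is the axis of the [i]-th cylinder. Choose integers [N] and [M_i]
    with [N * r_i ^+ 2 < M_i] and [\sum_i M_i <= N], and consider
      [F z = \prod_i |l_i z| ^+ (2 * M_i) * exp (- N * |z| ^+ 2)].
    A maximum point [p] of [F] over the unit ball lies in no cylinder, so the
    cylinders do not cover the ball. Two facts make this work.

    The point [p] maximizes [F] over the whole space ([weight_outside]). On a
    complex line through the origin the product is the squared modulus of a
    polynomial of degree at most [N], so by the maximum principle outside the
    unit disc its maximum grows from the unit circle to the circle of radius [d]
    by a factor of at most [d ^+ (2 * N)], which the Gaussian factor outweighs
    because [d ^+ 2 <= exp (d ^+ 2 - 1)].

    A global maximum point is far from every zero hyperplane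
    ([weight_slice]). If [l_i w = 0] and [v = p - w], then on the complex line
    [s |-> w + s v] the function [F] is
      [|s| ^+ (2 * M_i) * exp (- N * |v| ^+ 2 * |s| ^+ 2)]
    times the squared modulus of an entire function: the cross term of
    [|w + s v| ^+ 2] is the real part of a linear function of [s], and
    the exponential of a linear function has no zeros. By the maximum principle
    the maximum of the last factor over [|s| = d] cannot decrease in [d], whereas
    the first factor increases strictly as long as
    [N * |v| ^+ 2 * |s| ^+ 2 < M_i]. As [F] is maximal at [s = 1], this forces
    [M_i <= N * |v| ^+ 2], hence [|v| > r_i].

    The maximum principle is needed only for products of affine functions times
    the exponential of a linear one ([max_principle]). For these it follows from
    a discrete Laplacian: the product of [w + u] over the four rotations of [u]
    by powers of the imaginary unit is [w ^+ 4 - u ^+ 4], so the average of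
    [log |w + u|] over them is [log |w|] up to an error of fourth order in [u],
    smaller than the second-order gain of a perturbation [e * |s| ^+ 2]. *)

(** * Squared modulus of a complex number *)

Section SquaredModulus.
Variable R : realType.
Implicit Types (x y : R) (z w s t : R[i]).

Definition sqmod z : R := complex.Re z ^+ 2 + complex.Im z ^+ 2.

Lemma complexReD z w : complex.Re (z + w) = complex.Re z + complex.Re w.
Proof. by case: z w => [? ?] [? ?]. Qed.

Lemma complexImD z w : complex.Im (z + w) = complex.Im z + complex.Im w.
Proof. by case: z w => [? ?] [? ?]. Qed.

Lemma complexReM z w : complex.Re (z * w)
  = complex.Re z * complex.Re w - complex.Im z * complex.Im w.
Proof. by case: z w => [? ?] [? ?]. Qed.

Lemma complexImM z w : complex.Im (z * w)
  = complex.Re z * complex.Im w + complex.Im z * complex.Re w.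
Proof. by case: z w => [? ?] [? ?]. Qed.

Lemma sqmod_ge0 z : 0 <= sqmod z.
Proof. by rewrite addr_ge0 ?sqr_ge0. Qed.

Lemma sqmod_eq0 z : (sqmod z == 0) = (z == 0).
Proof. by rewrite paddr_eq0 ?sqr_ge0// !sqrf_eq0 eq_complex. Qed.

Lemma sqmodM z w : sqmod (z * w) = sqmod z * sqmod w.
Proof. rewrite /sqmod complexReM complexImM; ring. Qed.

Lemma sqmodX z k : sqmod (z ^+ k) = sqmod z ^+ k.
Proof.
elim: k => [|k IH]; last by rewrite !exprS sqmodM IH.
by rewrite !expr0 /sqmod /= expr1n expr0n addr0.
Qed.

Lemma sqmodJ z : sqmod z^*%C = sqmod z.
Proof. by case: z => a b; rewrite /sqmod /= sqrrN. Qed.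

Lemma sqmod_real x : sqmod x%:C%C = x ^+ 2.
Proof. by rewrite /sqmod /= expr0n addr0. Qed.

Lemma mulcJ_sqmod z : z * z^*%C = (sqmod z)%:C%C.
Proof.
case: z => a b; apply/eqP; rewrite eq_complex complexReM complexImM /sqmod /=.
by apply/andP; split; apply/eqP; ring.
Qed.

Lemma sqmodD z w :
  sqmod (z + w) = sqmod z + 2 * complex.Re (z * w^*%C) + sqmod w.
Proof. by case: z w => [a b] [c d]; rewrite /sqmod complexReM /=; ring. Qed.

(** The zeros of [w ^+ 4 - u ^+ 4] in [w] are the four rotations of [u]. This
    replaces the mean value property of [log |w + u|] over a circle. *)
Lemma prod4_sqmod w u :
  sqmod (w + u) * sqmod (w - u) * sqmod (w + 'i%C * u) * sqmod (w - 'i%C * u)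
  = sqmod (w ^+ 4 - u ^+ 4).
Proof.
rewrite -!sqmodM; congr sqmod.
have i2 : 'i%C ^+ 2 = -1 :> R[i] by exact: sqr_i.
have -> : w ^+ 4 - u ^+ 4 = (w^+2 - u^+2) * (w^+2 - 'i%C ^+ 2 * u^+2).
  by rewrite i2; ring.
by ring.
Qed.

End SquaredModulus.

(** * Continuity *)

Section Continuity.
Variables (R : realType) (T : topologicalType).
Implicit Types (f g : T -> R) (l : T -> R[i]).

Definition ccontinuous l :=
  continuous (fun x => complex.Re (l x)) /\ continuous (fun x => complex.Im (l x)).

Lemma ccontinuous_cst c : ccontinuous (fun=> c).
Proof. by split=> x; apply: cst_continuous. Qed.

Lemma ccontinuousD l1 l2 : ccontinuous l1 -> ccontinuous l2 ->
  ccontinuous (fun x => l1 x + l2 x).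
Proof.
move=> [a b] [c d]; split=> x.
- by under eq_fun do rewrite complexReD; apply: cvgD; [exact: a|exact: c].
- by under eq_fun do rewrite complexImD; apply: cvgD; [exact: b|exact: d].
Qed.

Lemma ccontinuousM l1 l2 : ccontinuous l1 -> ccontinuous l2 ->
  ccontinuous (fun x => l1 x * l2 x).
Proof.
move=> [a b] [c d]; split=> x.
- under eq_fun do rewrite complexReM.
  by apply: cvgB; apply: cvgM; (exact: a || exact: b || exact: c || exact: d).
- under eq_fun do rewrite complexImM.
  by apply: cvgD; apply: cvgM; (exact: a || exact: b || exact: c || exact: d).
Qed.

Lemma continuous_sqmod l : ccontinuous l -> continuous (fun x => sqmod (l x)).
Proof.
move=> [a b] x; apply: cvgD.
- by apply: (cvg_comp _ (fun y => y ^+ 2)); [exact: a|exact: exprn_continuous].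
- by apply: (cvg_comp _ (fun y => y ^+ 2)); [exact: b|exact: exprn_continuous].
Qed.

Lemma continuous_prodX (I : finType) (l : I -> T -> R[i]) (M : I -> nat) :
  (forall i, ccontinuous (l i)) ->
  continuous (fun x => \prod_i sqmod (l i x) ^+ M i).
Proof.
move=> lc x.
elim: (index_enum I) => [|i s IH].
  by under eq_fun do rewrite big_nil; apply: cst_continuous.
under eq_fun do rewrite big_cons.
apply: cvgM; last exact: IH.
apply: (cvg_comp _ (fun y => y ^+ M i)); last exact: exprn_continuous.
exact: continuous_sqmod.
Qed.

Lemma continuous_weighted (I : finType) (l : I -> T -> R[i]) (M : I -> nat) f :
  (forall i, ccontinuous (l i)) -> continuous f ->
  continuous (fun x => (\prod_i sqmod (l i x) ^+ M i) * expR (f x)).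
Proof.
move=> lc fc x; apply: cvgM; first exact: continuous_prodX.
by apply: (cvg_comp _ expR); [exact: fc|exact: continuous_expR].
Qed.

Lemma closed_sublevel f (r : R) : continuous f -> closed [set x | f x <= r].
Proof. by move=> /continuous_closedP /(_ _ (@closed_le _ r)). Qed.

End Continuity.

(** * Maximum principle *)

Section MaximumPrinciple.
Variable R : realType.
Implicit Types (x : R) (a b s t w : R[i]).

(** A lower bound [1 - O(y)] near [0] on the right: the form in which the
    fourth-order error of the discrete Laplacian is controlled, with [y] the
    fourth power of the step. It is stable under products. *)
Definition lin_below (f : R -> R) :=
  exists C, 0 <= C /\ forall y, 0 <= y -> C * y <= 1 -> 1 - C * y <= f y.

Lemma lin_below1 : lin_below (fun=> 1).
Proof. by exists 0; split=> // y _; rewrite mul0r subr0. Qed.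

Lemma lin_belowM f g : lin_below f -> lin_below g ->
  lin_below (fun y => f y * g y).
Proof.
move=> [C [C0 Hf]] [D [D0 Hg]]; exists (C + D); split; first exact: addr_ge0.
move=> y y0; rewrite mulrDl => Hy.
have Cy : 0 <= C * y by exact: mulr_ge0.
have Dy : 0 <= D * y by exact: mulr_ge0.
have C1 : C * y <= 1 by lra.
have D1 : D * y <= 1 by lra.
have F := Hf _ y0 C1; have G := Hg _ y0 D1.
apply: (@le_trans _ _ ((1 - C * y) * (1 - D * y))); first by nra.
by apply: ler_pM => //; lra.
Qed.

Lemma lin_belowX f m : lin_below f -> lin_below (fun y => f y ^+ m).
Proof.
move=> Hf; elim: m => [|m IH].
  by under eq_fun do rewrite expr0; exact: lin_below1.
by under eq_fun do rewrite exprS; exact: lin_belowM.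
Qed.

Lemma lin_below_prod (I : finType) (f : I -> R -> R) :
  (forall i, lin_below (f i)) -> lin_below (fun y => \prod_i f i y).
Proof.
move=> Hf; elim: (index_enum I) => [|i s IH].
  by under eq_fun do rewrite big_nil; exact: lin_below1.
by under eq_fun do rewrite big_cons; exact: lin_belowM.
Qed.

Lemma lin_below_sqmod (u : R[i]) : lin_below (fun y => sqmod (1 - y%:C%C * u)).
Proof.
exists (2 * `|complex.Re u|); split; first by rewrite mulr_ge0.
move=> x x0 _; case: u => c d; rewrite /sqmod /=.
have : x * c <= x * `|c| by rewrite ler_wpM2l// ler_norm.
have := sqr_ge0 (x * c); have := sqr_ge0 (x * d).
nra.
Qed.

Lemma compact_disc (r : R) :
  compact [set p : R * R | sqmod (p.1 +i* p.2)%C <= r].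
Proof.
have cc : ccontinuous (fun p : R * R => (p.1 +i* p.2)%C).
  by split=> p; [exact: cvg_fst|exact: cvg_snd].
pose b := `|r| + 1.
have cb : compact `[-b, b] by exact: segment_compact.
apply: (subclosed_compact _ (compact_setX cb cb)).
  exact: closed_sublevel (continuous_sqmod cc).
move=> [x y]; rewrite /sqmod /= => H.
have := ler_norm r; have := normr_ge0 r => r0 r1.
by split=> /=; rewrite in_itv /= /b; apply/andP; split; nra.
Qed.

Variables (I : finType) (M : I -> nat).
Implicit Types (al be : I -> R[i]).

Definition lineprod al be s := \prod_i sqmod (al i * s + be i) ^+ M i.

Lemma lineprod_ge0 al be s : 0 <= lineprod al be s.
Proof. by apply: prodr_ge0 => i _; rewrite exprn_ge0 ?sqmod_ge0. Qed.

(** The term [e * sqmod s] makes the logarithm of the function strictly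
    subharmonic. Its four neighbours [c + t], [c - t], [c + it], [c - it] at
    distance [h] gain a factor [expR (4 * e * h ^+ 2)] in their product, while
    the affine factors lose at most [1 - C * h ^+ 4]. *)
Lemma perturbed_no_max al be b c (e r : R) :
  let Psi s := lineprod al be s * expR (complex.Re (b * s) + e * sqmod s) in
  0 < e -> sqmod c < r -> 0 < Psi c ->
  exists2 s, sqmod s < r & Psi c < Psi s.
Proof.
move=> Psi e0 cr Pc; apply: contrapT => Hno.
have {Hno} cmax s : sqmod s < r -> Psi s <= Psi c.
  by move=> sr; rewrite leNgt; apply/negP => lt; apply: Hno; exists s.
pose w i := al i * c + be i.
pose u i := (al i / w i) ^+ 4.
have [C [C0 HC]] : lin_below (fun y => \prod_i sqmod (1 - y%:C%C * u i) ^+ M i).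
  by apply: lin_below_prod => i; apply: lin_belowX; exact: lin_below_sqmod.
pose A := 2 * (`|complex.Re c| + `|complex.Im c|) + 1.
have A0 : 0 <= A by rewrite addr_ge0// mulr_ge0// addr_ge0.
have [h [h0 h1 hA hC he]] : exists h : R,
    [/\ 0 < h, h <= 1, h * A < r - sqmod c, 4 * C * h <= 1 & C * h <= e].
  have d0 : 0 < r - sqmod c by rewrite subr_gt0.
  pose K := 1 + A / (r - sqmod c) + 4 * C + C / e.
  have q1 : 0 <= A / (r - sqmod c) by rewrite divr_ge0// ltW.
  have q2 : 0 <= C / e by rewrite divr_ge0// ltW.
  have K0 : 0 < K by rewrite /K; lra.
  exists K^-1; split; first by rewrite invr_gt0.
  - by rewrite invf_le1// /K; lra.
  - rewrite mulrC ltr_pdivrMr// mulrC -ltr_pdivrMr// /K; lra.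
  - rewrite ler_pdivrMr// mul1r /K; lra.
  - rewrite ler_pdivrMr// mulrC -ler_pdivrMr// /K; lra.
pose t := h%:C%C.
have near s : `|complex.Re s| <= h -> `|complex.Im s| <= h -> sqmod s <= h ^+ 2 ->
    sqmod (c + s) < r.
  move=> s1 s2 s3; rewrite sqmodD.
  have : complex.Re (c * s^*%C) <= (`|complex.Re c| + `|complex.Im c|) * h.
    case: (c) s s1 s2 {s3} => c1 c2 [x y] /= xh yh.
    rewrite mulrN opprK mulrDl; apply: lerD; apply: le_trans (ler_norm _) _;
      by rewrite normrM ler_wpM2l.
  rewrite /A in hA; nra.
have n0 : `|0 : R| <= h by rewrite normr0 ltW.
have nh : `|h| <= h by rewrite ger0_norm// ltW.
have it : 'i%C * t = (0 +i* h)%C.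
  by apply/eqP; rewrite eq_complex complexReM complexImM /=; apply/andP; split; apply/eqP; ring.
have P1 : Psi (c + t) <= Psi c.
  by apply/cmax/near => //; rewrite sqmod_real.
have P2 : Psi (c - t) <= Psi c.
  by apply/cmax/near; rewrite /sqmod /= ?normrN ?oppr0// sqrrN expr0n addr0.
have P3 : Psi (c + 'i%C * t) <= Psi c.
  by rewrite it; apply/cmax/near; rewrite /sqmod //= expr0n add0r.
have P4 : Psi (c - 'i%C * t) <= Psi c.
  by rewrite it; apply/cmax/near;
    rewrite /sqmod /= ?oppr0 ?normrN// sqrrN expr0n add0r.
have Psi0 s : 0 <= Psi s.
  by rewrite mulr_ge0 ?expR_ge0 ?lineprod_ge0.
have : Psi (c + t) * Psi (c - t) * Psi (c + 'i%C * t) * Psi (c - 'i%C * t)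
    <= Psi c * Psi c * Psi c * Psi c.
  by move: P1 P2 P3 P4 (Psi0 (c + t)) (Psi0 (c - t)) (Psi0 (c + 'i%C * t))
    (Psi0 (c - 'i%C * t)); move: (Psi _) (Psi _) (Psi _) (Psi _) (Psi _) => *;
    rewrite !ler_pM ?mulr_ge0.
have W0 : 0 < lineprod al be c.
  by move: Pc; rewrite /Psi pmulr_lgt0 ?expR_gt0.
have four (i : I) : sqmod (al i * (c + t) + be i) ^+ M i *
    sqmod (al i * (c - t) + be i) ^+ M i *
    sqmod (al i * (c + 'i%C * t) + be i) ^+ M i *
    sqmod (al i * (c - 'i%C * t) + be i) ^+ M i =
    (sqmod (w i) ^+ M i) ^+ 4 * sqmod (1 - (h ^+ 4)%:C%C * u i) ^+ M i.
  (* a factor of exponent 0 may vanish at c; the others do not *)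
  have [->|Mi] := eqVneq (M i) 0%N; first by rewrite !expr0 expr1n !mulr1.
  have wi : w i != 0.
    apply/negP => /eqP wi0; move: W0; rewrite /lineprod (bigD1 i)//= -/(w i) wi0.
    by rewrite /sqmod /= expr0n add0r expr0n (negbTE Mi) mul0r ltxx.
  have -> : al i * (c + t) + be i = w i + al i * t by rewrite /w; ring.
  have -> : al i * (c - t) + be i = w i - al i * t by rewrite /w; ring.
  have -> : al i * (c + 'i%C * t) + be i = w i + 'i%C * (al i * t) by rewrite /w; ring.
  have -> : al i * (c - 'i%C * t) + be i = w i - 'i%C * (al i * t) by rewrite /w; ring.
  rewrite -!exprMn prod4_sqmod exprAC -exprMn; congr (_ ^+ _).
  rewrite -sqmodX -sqmodM; congr sqmod.
  have -> : (h ^+ 4)%:C%C = t ^+ 4 by rewrite rmorphXn.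
  by rewrite /u; field.
have -> : Psi (c + t) * Psi (c - t) * Psi (c + 'i%C * t) * Psi (c - 'i%C * t) =
    lineprod al be c ^+ 4 * (\prod_i sqmod (1 - (h ^+ 4)%:C%C * u i) ^+ M i) *
    (expR (complex.Re (b * c) + e * sqmod c) ^+ 4 * expR (4 * e * h ^+ 2)).
  rewrite /lineprod -prodrXl -big_split /=; under [in RHS]eq_bigr do rewrite -four.
  rewrite !big_split /= -expRM_natl -expRD.
  have -> : 4%:R * (complex.Re (b * c) + e * sqmod c) + 4 * e * h ^+ 2 =
      (complex.Re (b * (c + t)) + e * sqmod (c + t)) +
      (complex.Re (b * (c - t)) + e * sqmod (c - t)) +
      (complex.Re (b * (c + 'i%C * t)) + e * sqmod (c + 'i%C * t)) +
      (complex.Re (b * (c - 'i%C * t)) + e * sqmod (c - 'i%C * t)).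
    by case: (b) (c) => [b1 b2] [c1 c2]; rewrite /sqmod /=; ring.
  by rewrite /Psi /lineprod !expRD; ring.
have -> : Psi c * Psi c * Psi c * Psi c = lineprod al be c ^+ 4 *
    expR (complex.Re (b * c) + e * sqmod c) ^+ 4 by rewrite /Psi; ring.
rewrite mulrACA.
rewrite ger_pMr; last by rewrite mulr_gt0 ?exprn_gt0 ?expR_gt0.
set G := \prod_i _; move=> Gle.
have h2 : h ^+ 2 <= h by nra.
have h4 : h ^+ 4 <= h ^+ 2 * h by rewrite -exprSr ler_wiXn2l// ltW.
have hh : 0 < h ^+ 2 by exact: exprn_gt0.
have h4C : C * h ^+ 4 <= C * (h ^+ 2 * h) by rewrite ler_wpM2l.
have c1 : C * h ^+ 4 <= h ^+ 2 * e by nra.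
have c2 : C * h ^+ 4 <= 1 / 4 by nra.
have G1 : 1 - C * h ^+ 4 <= G.
  by apply: HC; [rewrite exprn_ge0// ltW|lra].
have E1 := expR_ge1Dx (4 * e * h ^+ 2).
have : (1 - C * h ^+ 4) * (1 + 4 * e * h ^+ 2) <= 1.
  apply: le_trans Gle; apply: ler_pM => //; first by lra.
  by rewrite addr_ge0// !mulr_ge0// ltW.
have := mulr_gt0 e0 hh; nra.
Qed.

(** A value above the bound at an interior point would survive a small
    perturbation [e * sqmod s], whose maximum over the disc would then be
    interior, against [perturbed_no_max]. *)
Lemma max_principle al be b (C r : R) a :
  (forall s, sqmod s = r -> lineprod al be s * expR (complex.Re (b * s)) <= C) ->
  sqmod a <= r ->
  lineprod al be a * expR (complex.Re (b * a)) <= C.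
Proof.
move=> HC ar; rewrite leNgt; apply/negP => Ca.
pose Phi s := lineprod al be s * expR (complex.Re (b * s)).
have Phi_ge0 s : 0 <= Phi s.
  by rewrite mulr_ge0 ?expR_ge0 ?lineprod_ge0.
have r0 : 0 <= r by rewrite (le_trans (sqmod_ge0 a)).
have C0 : 0 <= C.
  apply: le_trans (Phi_ge0 (Num.sqrt r)%:C%C) (HC _ _).
  by rewrite sqmod_real sqr_sqrtr.
(* e is so small that the perturbed function stays below Phi a on the circle *)
have [e e0 He] : exists2 e, 0 < e & C * expR (e * r) < Phi a.
  have [->|Cn0] := eqVneq C 0.
    by exists 1 => //; rewrite mul0r (le_lt_trans C0).
  have Cp : 0 < C by rewrite lt_neqAle eq_sym Cn0.
  have q1 : 1 < Phi a / C by rewrite ltr_pdivlMr // mul1r.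
  exists (ln (Phi a / C) / (r + 1)).
    by rewrite divr_gt0 ?ln_gt0//; lra.
  rewrite mulrC -ltr_pdivlMr// -ltr_ln ?posrE ?expR_gt0 ?(lt_trans ltr01)//.
  rewrite expRK -mulrA gtr_pMr ?ln_gt0// ltr_pdivrMl; lra.
pose Psi s := lineprod al be s * expR (complex.Re (b * s) + e * sqmod s).
have PsiE s : Psi s = Phi s * expR (e * sqmod s).
  by rewrite /Psi expRD mulrA.
pose D := [set p : R * R | sqmod (p.1 +i* p.2)%C <= r].
have Psic : continuous (fun p : R * R => Psi (p.1 +i* p.2)%C).
  have cc : ccontinuous (fun p : R * R => (p.1 +i* p.2)%C).
    by split=> p; [exact: cvg_fst|exact: cvg_snd].
  apply: continuous_weighted => [i|].
    by apply: ccontinuousD; [apply: ccontinuousM|] => //; exact: ccontinuous_cst.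
  have [h _] := ccontinuousM (ccontinuous_cst _ b) cc.
  move=> p; apply: cvgD; first exact: h.
  by apply: cvgM; [exact: cvg_cst|exact: continuous_sqmod].
have [] := @compact_EVT_max _ _ _ D _ (@compact_disc r) (continuous_subspaceT Psic).
  by exists (complex.Re a, complex.Im a); rewrite /D /=; case: a ar {Ca He}.
move=> [c1 c2]; rewrite inE /D /=; set c := (c1 +i* c2)%C => cr cmax.
have {}cmax s : sqmod s <= r -> Psi s <= Psi c.
  by case: s => s1 s2 sr; have := cmax (s1, s2); rewrite inE; exact.
have ac : Phi a <= Psi c.
  apply: le_trans (cmax a ar); rewrite PsiE ler_peMr//.
  by rewrite -expR0 ler_expR mulr_ge0 ?sqmod_ge0// ltW.
have {ac} He : C * expR (e * r) < Psi c by exact: lt_le_trans ac.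
have {cr} cr : sqmod c < r.
  rewrite lt_neqAle cr andbT; apply/eqP => cr'.
  by move: He; rewrite PsiE cr' ltr_pM2r ?expR_gt0// ltNge HC.
have Psi0 : 0 < Psi c by rewrite (le_lt_trans _ He)// mulr_ge0 ?expR_ge0.
have [s sr] := perturbed_no_max e0 cr Psi0.
by rewrite ltNge cmax// ltW.
Qed.
End MaximumPrinciple.

(** * Hermitian geometry of complex lines *)

Section Weight.
Variables (R : realType) (n : nat).
Implicit Types (u v w z p q : Cspace R n) (s : R[i]) (a : 'rV[R[i]]_n).

Definition hsq z : R := \sum_(j < n) sqmod (zcoord z j).

Lemma hnormE z : hnorm z = Num.sqrt (hsq z).
Proof.
congr Num.sqrt; rewrite /hform /hsq.
elim: (index_enum _) => [|j r IH]; first by rewrite !big_nil.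
by rewrite !big_cons complexReD IH mulcJ_sqmod.
Qed.

Lemma hsq_ge0 z : 0 <= hsq z.
Proof. by apply: sumr_ge0 => j _; exact: sqmod_ge0. Qed.

Lemma hnorm_le z (r : R) : 0 <= r -> (hnorm z <= r) = (hsq z <= r ^+ 2).
Proof.
move=> r0; rewrite hnormE -(@ler_pXn2r _ 2%N) ?nnegrE ?sqrtr_ge0//.
by rewrite sqr_sqrtr ?hsq_ge0.
Qed.

Definition cscale s z : Cspace R n :=
  (\row_j complex.Re (s * zcoord z j), \row_j complex.Im (s * zcoord z j)).

Lemma zcoordD u v j : zcoord (u + v) j = zcoord u j + zcoord v j.
Proof. by rewrite /zcoord /= !mxE. Qed.

Lemma zcoord_cscale s z j : zcoord (cscale s z) j = s * zcoord z j.
Proof. by rewrite /zcoord /cscale /= !mxE; case: (s * _). Qed.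

Lemma eq_zcoord u v : zcoord u =1 zcoord v -> u = v.
Proof.
case: u v => [u1 u2] [v1 v2] uv.
by congr (_, _); apply/rowP => j; have [] := uv j.
Qed.

Lemma cscale1 z : cscale 1 z = z.
Proof. by apply: eq_zcoord => j; rewrite zcoord_cscale mul1r. Qed.

Lemma hsq_cscale s z : hsq (cscale s z) = sqmod s * hsq z.
Proof.
by rewrite /hsq mulr_sumr; apply: eq_bigr => j _; rewrite zcoord_cscale sqmodM.
Qed.

Lemma hsq_line w v s : hsq (w + cscale s v) =
  hsq w + 2 * complex.Re (s * hform v w) + sqmod s * hsq v.
Proof.
rewrite /hsq /hform !mulr_sumr.
elim: (index_enum _) => [|j r IH].
  by rewrite !big_nil mulr0 !addr0.
rewrite !big_cons {}IH complexReD mulrDr zcoordD zcoord_cscale addrC.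
rewrite [zcoord w j + _]addrC sqmodD sqmodM mulrA; ring.
Qed.

Definition cform a z : R[i] := \sum_(j < n) a 0 j * zcoord z j.

Lemma cform_line a w v s : cform a (w + cscale s v) = cform a w + s * cform a v.
Proof.
rewrite /cform mulr_sumr -big_split; apply: eq_bigr => j _.
by rewrite zcoordD zcoord_cscale mulrDr mulrCA.
Qed.

Lemma cform_cscale a s z : cform a (cscale s z) = s * cform a z.
Proof.
by rewrite /cform mulr_sumr; apply: eq_bigr => j _; rewrite zcoord_cscale mulrCA.
Qed.

Lemma ccontinuous_zcoord j : ccontinuous (fun z => zcoord z j).
Proof.
split=> z.
- by apply: (cvg_comp fst (fun A : 'rV[R]_n => A 0 j));
    [exact: cvg_fst|exact: coord_continuous].
- by apply: (cvg_comp snd (fun A : 'rV[R]_n => A 0 j));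
    [exact: cvg_snd|exact: coord_continuous].
Qed.

Lemma ccontinuous_cform a : ccontinuous (cform a).
Proof.
rewrite /cform; elim: (index_enum _) => [|j r IH].
  by under eq_fun do rewrite big_nil; exact: ccontinuous_cst.
under eq_fun do rewrite big_cons; apply: ccontinuousD => //.
by apply: ccontinuousM; [exact: ccontinuous_cst|exact: ccontinuous_zcoord].
Qed.

Lemma continuous_hsq : continuous hsq.
Proof.
rewrite /hsq => z; elim: (index_enum _) => [|j r IH].
  by under eq_fun do rewrite big_nil; exact: cst_continuous.
under eq_fun do rewrite big_cons.
by apply: cvgD => //; apply: continuous_sqmod; exact: ccontinuous_zcoord.
Qed.

Lemma compact_ball (r : R) : compact [set z | hsq z <= r].
Proof.
pose b := `|r| + 1.
pose K := [set x : 'rV[R]_n | forall j, `[-b, b]%classic (x 0 j)].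
have cK : compact K.
  exact: (@rV_compact _ _ (fun=> `[-b, b]%classic) (fun=> @segment_compact _ _ _)).
apply: (subclosed_compact _ (compact_setX cK cK)).
  exact: closed_sublevel continuous_hsq.
move=> z /= zr.
have zj j : sqmod (zcoord z j) <= r.
  rewrite (le_trans _ zr)// /hsq (bigD1 j)//= lerDl.
  by apply: sumr_ge0 => *; exact: sqmod_ge0.
have := ler_norm r; have := normr_ge0 r => r0 r1.
by split=> j /=; have := zj j; rewrite /sqmod /= in_itv /= /b => H;
  apply/andP; split; nra.
Qed.

(** * The weighted product of affine forms *)

Variables (I : finType) (a : I -> 'rV[R[i]]_n) (c : I -> R[i]).
Variables (M : I -> nat) (N : nat).

Definition weight z : R :=
  (\prod_i sqmod (cform (a i) z - c i) ^+ M i) * expR (- (N%:R * hsq z)).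

Lemma weight_ge0 z : 0 <= weight z.
Proof.
by rewrite mulr_ge0 ?expR_ge0// prodr_ge0// => i _; rewrite exprn_ge0 ?sqmod_ge0.
Qed.

Lemma weight_max_ball : exists2 p, hsq p <= 1 &
  forall q, hsq q <= 1 -> weight q <= weight p.
Proof.
have wc : continuous weight.
  apply: continuous_weighted => [i|].
    by apply: ccontinuousD; [exact: ccontinuous_cform|exact: ccontinuous_cst].
  move=> z; apply: cvgN; apply: cvgM; [exact: cvg_cst|exact: continuous_hsq].
have [] := @compact_EVT_max _ _ _ [set z | hsq z <= 1] _
  (@compact_ball 1) (continuous_subspaceT wc).
  exists 0; rewrite /= /hsq big1// => j _.
  by rewrite /zcoord !mxE /sqmod /= expr0n addr0.
move=> p; rewrite inE /= => p1 pm; exists p => // q q1.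
by apply: pm; rewrite inE.
Qed.

(** Bernstein-Walsh growth estimate. With [u = q / |q|], the factors at the point
    [u / s] are [(cform (a i) u - c i * s) / s], so the maximum principle
    applies in the variable [s] on the unit disc, at [s = 1 / |q|]. *)
Lemma weight_outside (C : R) q : (\sum_i M i <= N)%N ->
  (forall z, hsq z = 1 -> weight z <= C) -> 1 < hsq q -> weight q <= C.
Proof.
move=> MN HC; set x := hsq q => x1.
have x0 : 0 < x by rewrite (lt_trans _ x1).
pose d := Num.sqrt x.
have d0 : 0 < d by rewrite sqrtr_gt0.
have d2 : d ^+ 2 = x by rewrite sqr_sqrtr// ltW.
pose u := cscale (d^-1)%:C%C q.
have u1 : hsq u = 1.
  by rewrite hsq_cscale sqmod_real exprVn d2 mulVf// gt_eqF.
have qE : q = cscale d%:C%C u.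
  apply: eq_zcoord => j; rewrite !zcoord_cscale mulrA -rmorphM mulfV ?gt_eqF//.
  by rewrite rmorph1 mul1r.
pose al i := - c i; pose be i := cform (a i) u.
have Phi1 s : sqmod s = 1 ->
    lineprod M al be s * expR (complex.Re (0 * s)) <= C * expR N%:R.
  move=> s1; rewrite mul0r expR0 mulr1 -ler_pdivrMr ?expR_gt0// -expRN.
  (* on the unit circle the inverse of s is its conjugate *)
  have h1 : hsq (cscale s^*%C u) = 1 by rewrite hsq_cscale sqmodJ s1 mul1r.
  apply: le_trans (HC _ h1); rewrite /weight h1 mulr1 ler_wpM2r ?expR_ge0//.
  rewrite le_eqVlt; apply/orP; left; apply/eqP; apply: eq_bigr => i _.
  congr (_ ^+ _); rewrite cform_cscale -[RHS]mul1r -s1 -sqmodM mulrBr mulrA.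
  rewrite mulcJ_sqmod s1 rmorph1 mul1r /al /be; congr sqmod; ring.
have s1 : sqmod (d^-1)%:C%C <= 1.
  by rewrite sqmod_real exprVn d2 invf_le1// ltW.
have := max_principle Phi1 s1; rewrite mul0r expR0 mulr1 => Phid.
have -> : weight q =
    x ^+ (\sum_i M i) * lineprod M al be (d^-1)%:C%C * expR (- (N%:R * x)).
  rewrite /weight -/x -prodrXr -big_split /=; congr (_ * _).
  apply: eq_bigr => i _; rewrite -exprMn; congr (_ ^+ _).
  rewrite -d2 -sqmod_real -sqmodM {1}qE cform_cscale /al /be; congr sqmod.
  have dV : d%:C%C * (d^-1)%:C%C = 1 :> R[i].
    by rewrite -rmorphM mulfV ?gt_eqF// rmorph1.
  rewrite -[X in _ - X]mul1r -dV; ring.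
have C0 : 0 <= C by rewrite (le_trans (weight_ge0 u))// HC.
have xN : x ^+ (\sum_i M i) <= expR (N%:R * (x - 1)).
  apply: (@le_trans _ _ (x ^+ N)); first by rewrite ler_weXn2l// ltW.
  rewrite expRM_natl lerXn2r ?nnegrE ?expR_ge0 ?(ltW x0)//.
  by have := expR_ge1Dx (x - 1); lra.
apply: (@le_trans _ _ (expR (N%:R * (x - 1)) * (C * expR N%:R)
  * expR (- (N%:R * x)))).
  rewrite ler_wpM2r ?expR_ge0// ler_pM// ?lineprod_ge0 ?exprn_ge0 ?(ltW x0)//.
rewrite [X in X * _]mulrCA -mulrA -2!expRD.
have -> : N%:R * (x - 1) + N%:R + - (N%:R * x) = 0 :> R by ring.
by rewrite expR0 mulr1.
Qed.

(** On the line [w + s v] the weight is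
    [sqmod s ^+ M i * expR (- (N%:R * hsq v * sqmod s))] times a function that
    satisfies the maximum principle. Comparing [s = 1] with the circles
    [sqmod s = x], [1 < x], gives
    [x ^+ M i <= expR (N%:R * hsq v * (x - 1))]. *)
Lemma weight_slice w v i : weight (w + v) != 0 ->
  (forall z, weight z <= weight (w + v)) -> cform (a i) w = c i ->
  (M i)%:R <= N%:R * hsq v.
Proof.
set p := w + v; rewrite neq_lt ltNge weight_ge0 /= => wp wmax wi.
set t := N%:R * hsq v.
have t0 : 0 <= t by rewrite mulr_ge0 ?hsq_ge0.
(* let x tend to 1 *)
suff H x : 1 < x -> (M i)%:R <= t * x.
  rewrite leNgt; apply/negP => tM.
  have M0 : 0 < (M i)%:R + t by rewrite ltr_wpDr// (le_lt_trans _ tM).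
  have := H (2 * (M i)%:R / ((M i)%:R + t)).
  rewrite ltr_pdivlMr// mul1r mulrA ler_pdivlMr// => /(_ ltac:(lra)).
  nra.
move=> x1; have x0 : 0 < x by rewrite (lt_trans _ x1).
(* the factor of index i is s * cform (a i) v; its s is split off *)
pose al j := if j == i then 0 else cform (a j) v.
pose be j := if j == i then cform (a i) v else cform (a j) w - c j.
pose b := (- (2 * N%:R))%:C%C * hform v w.
pose Phi s := lineprod M al be s * expR (complex.Re (b * s)).
pose E := expR (- (N%:R * hsq w)).
have E0 : 0 < E := expR_gt0 _.
have wE s : weight (w + cscale s v) =
    sqmod s ^+ M i * E * expR (- (t * sqmod s)) * Phi s.
  have -> : weight (w + cscale s v) = sqmod s ^+ M i * lineprod M al be s *
      expR (- (N%:R * hsq (w + cscale s v))).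
    rewrite /weight; congr (_ * _).
    rewrite /lineprod (bigD1 i)//= [in RHS](bigD1 i)//= mulrA; congr (_ * _).
      rewrite -exprMn -sqmodM; congr (sqmod _ ^+ _).
      rewrite cform_line wi /al /be eqxx; ring.
    apply: eq_bigr => j ji; congr (sqmod _ ^+ _).
    rewrite cform_line /al /be (negbTE ji); ring.
  have -> : - (N%:R * hsq (w + cscale s v)) =
      - (N%:R * hsq w) + - (t * sqmod s) + complex.Re (b * s).
    have -> : complex.Re (b * s) = - (2 * N%:R) * complex.Re (s * hform v w).
      by rewrite /b -mulrA complexReM mul0r subr0 [s * _]mulrC.
    rewrite hsq_line /t; ring.
  rewrite !expRD /Phi /E; ring.
have PhiB s : sqmod s = x ->
    lineprod M al be s * expR (complex.Re (b * s)) <=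
    weight p / (x ^+ M i * E * expR (- (t * x))).
  move=> sx; rewrite -/(Phi s) ler_pdivlMr ?mulr_gt0 ?exprn_gt0 ?expR_gt0//.
  by rewrite mulrC -{1 2}sx -wE.
have one_le : sqmod 1 <= x by rewrite /sqmod /= expr1n expr0n addr0 ltW.
have wpE : weight p = E * expR (- t) * Phi 1.
  rewrite /p -{1}(cscale1 v) wE.
  by rewrite /sqmod /= expr1n expr0n addr0 expr1n mul1r mulr1.
have P1 : 0 < Phi 1.
  by move: wp; rewrite wpE pmulr_rgt0// mulr_gt0 ?expR_gt0.
have := max_principle PhiB one_le; rewrite -/(Phi 1) wpE.
rewrite ler_pdivlMr ?mulr_gt0 ?exprn_gt0 ?expR_gt0//.
rewrite mulrC ler_pM2r// [x ^+ _ * E]mulrC -mulrA ler_pM2l//.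
rewrite !expRN -ler_pdivlMr ?invr_gt0 ?expR_gt0// invrK -expRN -expRD => xM.
have xge : expR (1 - x^-1) <= x.
  rewrite -[leRHS]invrK -[leLHS]invrK lef_pV2 ?posrE ?invr_gt0 ?expR_gt0//.
  by rewrite -expRN opprB; have := expR_ge1Dx (x^-1 - 1); lra.
have : expR ((M i)%:R * (1 - x^-1)) <= expR (- t + t * x).
  apply: le_trans xM; rewrite expRM_natl.
  by rewrite lerXn2r ?nnegrE ?expR_ge0 ?(ltW x0).
rewrite ler_expR => le1.
have xV : x * x^-1 = 1 by rewrite mulfV// gt_eqF.
have : (M i)%:R * (x - 1) <= t * x * (x - 1).
  have -> : (M i)%:R * (x - 1) = x * ((M i)%:R * (1 - x^-1)) :> R.
    by rewrite [RHS]mulrCA [x * (_ - _)]mulrBr mulr1 xV.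
  have -> : t * x * (x - 1) = x * (- t + t * x) by ring.
  by rewrite ler_wpM2l// ltW.
by rewrite ler_pM2r// subr_gt0.
Qed.

(** On the moment curve [t |-> (t, .., t ^+ n)] each affine form restricts to a
    nonzero polynomial in [t], so some natural number [t] is a root of none. *)
Lemma weight_nonzero : (forall i, a i != 0) -> exists z, weight z != 0.
Proof.
move=> a0.
pose P i : {poly R[i]} := \sum_(j < n) a i 0 j *: 'X^(j.+1) - (c i)%:P.
have P0 i : P i != 0.
  apply/eqP => /polyP Pi0; case/eqP: (a0 i); apply/rowP => j; rewrite mxE.
  have := Pi0 j.+1; rewrite coefB coefC coef0 subr0 coef_sum (bigD1 j)//=.
  rewrite coefZ coefXn eqxx mulr1 big1 ?addr0// => l lj.
  by rewrite coefZ coefXn eqSS eq_sym (inj_eq val_inj) (negbTE lj) mulr0.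
pose Q := \prod_i P i.
have Q0 : Q != 0 by apply/prodf_neq0 => i _.
pose rs : seq R[i] := [seq m%:R | m <- iota 0 (size Q)].
have urs : uniq rs.
  by rewrite map_inj_uniq ?iota_uniq// => x y /eqP; rewrite eqr_nat => /eqP.
have /allPn[t _ Qt] : ~~ all (root Q) rs.
  by apply/negP => /(max_poly_roots Q0)/(_ urs); rewrite size_map size_iota ltnn.
pose z : Cspace R n :=
  (\row_j complex.Re (t ^+ j.+1), \row_j complex.Im (t ^+ j.+1)).
have zE j : zcoord z j = t ^+ j.+1.
  by rewrite /zcoord !mxE; case: (t ^+ _).
exists z; apply: mulf_neq0; last by rewrite gt_eqF ?expR_gt0.
apply/prodf_neq0 => i _; rewrite expf_neq0// sqmod_eq0.
have -> : cform (a i) z - c i = (P i).[t].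
  rewrite hornerD hornerN hornerC horner_sum; congr (_ - _).
  by apply: eq_bigr => j _; rewrite zE hornerZ hornerXn.
apply: contra Qt => Pt; rewrite /root horner_prod.
by apply/prodf_eq0; exists i.
Qed.

(** A plank theorem for complex affine hyperplanes, where [M i / N] plays the
    role of a squared radius. *)
Lemma far_from_hyperplanes : (forall i, a i != 0) -> (\sum_i M i <= N)%N ->
  exists2 p, hsq p <= 1 &
    forall i w, cform (a i) w = c i -> (M i)%:R <= N%:R * hsq (p - w).
Proof.
move=> a0 MN; have [p p1 pmax] := weight_max_ball.
have {}pmax q : weight q <= weight p.
  have [/pmax//|q1] := leP (hsq q) 1.
  by apply: (weight_outside MN) q1 => z z1; rewrite pmax// z1.
have [z z0] := weight_nonzero a0.
have wp : weight p != 0.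
  by rewrite gt_eqF// (lt_le_trans _ (pmax z))// lt_neqAle eq_sym z0 weight_ge0.
exists p => // i w wi; apply: (@weight_slice w) => //; by rewrite addrC subrK.
Qed.

End Weight.

(** * Covering the ball by unitary cylinders *)

(* Complex dimension n >= 1 is written n.+1 with n : nat. *)
Theorem lemma4p3 (R : realType)
  (subadditivity : forall (n : nat) (K : set (Cspace R n.+1)) (k : nat)
      (Z : 'I_k -> set (Cspace R n.+1)),
    convex_body K -> (forall i, convex_symplectic_cylinder (Z i)) ->
    K `<=` \bigcup_i Z i ->
    (hz_capacity K <= \sum_(i < k) hz_capacity (Z i))%E) :
  forall (n k : nat) (Z : 'I_k -> set (Cspace R n.+1)) (r : 'I_k -> R),
    (forall i, 0 < r i) -> (forall i, unitary_cylinder (r i) (Z i)) ->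
    @unit_ball R n.+1 `<=` \bigcup_i Z i ->
    1 <= \sum_(i < k) r i ^+ 2.
Proof.
move=> n k Z r r0 Zcyl cover; rewrite leNgt; apply/negP => S1.
have /choice[ac acP] i : exists ac : 'rV[R[i]]_n.+1 * R[i], ac.1 != 0 /\
    Z i = hneighborhood [set z | cform ac.1 z = ac.2] (r i).
  by have [_ [a [c [a0 ->]]] ->] := Zcyl i; exists (a, c).
pose S := \sum_(i < k) r i ^+ 2.
have d0 : 0 < 1 - S by rewrite subr_gt0.
(* N is so large that the k numbers N * r i ^+ 2, rounded up, still have a sum
   of at most N *)
pose N := (Num.truncn (k%:R / (1 - S))).+1.
pose M i := (Num.truncn (N%:R * r i ^+ 2)).+1.
have MN : (\sum_i M i <= N)%N.
  rewrite -(ler_nat R) natr_sum.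
  apply: (@le_trans _ _ (\sum_(i < k) (N%:R * r i ^+ 2 + 1))).
    apply: ler_sum => i _; rewrite /M -natr1 lerD2r truncn_le.
    by rewrite mulr_ge0 ?sqr_ge0.
  rewrite big_split /= -mulr_sumr sumr_const card_ord -/S.
  have : k%:R / (1 - S) < N%:R by exact: truncnS_gt.
  rewrite ltr_pdivrMr//; lra.
have [p p1 far] := far_from_hyperplanes (fun i => (ac i).2)
  (fun i => (acP i).1) MN.
have pball : unit_ball p by rewrite /unit_ball /= hnorm_le// expr1n.
have [i _] := cover p pball.
rewrite (acP i).2 => -[w wi]; rewrite hnorm_le ?(ltW (r0 i))// => near.
have := far i w wi; apply/negP; rewrite -ltNge.
apply: (@le_lt_trans _ _ (N%:R * r i ^+ 2)); first by rewrite ler_wpM2l.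
exact: truncnS_gt.
Qed.
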